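(* Let $n\ge 0$ be a fixed integer. For $\omega>0$ let $E_{n,\omega}^c=\min_{r\in\mathcal{R}_n}\|r-\exp(\omega\,\cdot)\|$ and $E_{n,\omega}^u=\min_{r\in\mathcal{U}_n}\|r-\exp(\omega\,\cdot)\|$ be the errors of the Chebyshev approximation and of the unitary best approximation, respectively. Then, for $\omega\to 0$, $$E_{n,\omega}^u=\frac{2^{-2n}(n!)^2}{(2n)!\,(2n+1)!}\,\omega^{2n+1}+\mathcal{O}(\omega^{2n+2})\quad\text{and}\quad E_{n,\omega}^c=\frac{2^{-2n}(n!)^2}{(2n)!\,(2n+1)!}\,\omega^{2n+1}+\mathcal{O}(\omega^{2n+2}).$$
   Context: Polynomials have complex coefficients. $\mathcal{R}_n=\{p/q : p,q \text{ polynomials of degree}\le n,\ q\not\equiv 0\}$ is the set of rational functions of degree at most $(n,n)$ (as usual, common factors of $p$ and $q$ are cancelled, so removable singularities are removed). $\mathcal{U}_n=\{r\in\mathcal{R}_n : |r(\mathrm{i}x)|=1 \text{ for all } x\in\mathbb{R}\}$ is the set of unitary rational functions. For a complex function $g$, $\|g\|:=\max_{x\in[-1,1]}|g(\mathrm{i}x)|$ (regarded as $+\infty$ if $g$ has a pole on $\mathrm{i}[-1,1]$), so $\|r-\exp(\omega\,\cdot)\|=\max_{x\in[-1,1]}|r(\mathrm{i}x)-\mathrm{e}^{\mathrm{i}\omega x}|$. Both minima are known to be attained. *)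

(* Defs.v *)
(* The complex numbers are R[i], for an arbitrary R : realType. *)
From HB Require Import structures.
From mathcomp Require Import all_boot all_order all_algebra.
From mathcomp Require Import complex.
From mathcomp Require Import all_classical all_reals all_analysis.

Set Implicit Arguments.
Unset Strict Implicit.
Unset Printing Implicit Defensive.

Import Order.TTheory GRing.Theory Num.Theory.
Import numFieldNormedType.Exports.

Local Open Scope classical_set_scope.
Local Open Scope ring_scope.
Local Open Scope complex_scope.

Notation "x %:F" := (@FracField.tofrac _ x) : ring_scope.

Section ComplexFunctions.
Variable R : realType.
Implicit Types (z : R[i]) (w : R).

Definition cmod z : R := ComplexField.Normc.normc z.

Definition cexp z : R[i] :=
  (expR (complex.Re z))%:C * (cos (complex.Im z) +i* sin (complex.Im z)).

(* [absg] stands for the modulus of a function, equal to +oo at its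
   poles. The maximum over the compact segment i[-1, 1] is written as a
   supremum (the two agree whenever the maximum exists, see inorm_max). *)
Definition inorm (absg : R[i] -> \bar R) : \bar R :=
  ereal_sup [set absg (x *i) | x in `[-1, 1]].

End ComplexFunctions.

Section RationalFunctions.
Variable R : realType.
Local Notation ratfun := {fraction {poly R[i]}}.
Implicit Types (r : ratfun) (z : R[i]) (n : nat) (S : set ratfun).

(* Numerator and denominator of [r] in lowest terms: they are obtained from an
   arbitrary representative by cancelling the common factors, and are unique up
   to a common nonzero constant. *)
Definition rnum r : {poly R[i]} :=
  (repr r).1 %/ gcdp (repr r).1 (repr r).2.
Definition rden r : {poly R[i]} :=
  (repr r).2 %/ gcdp (repr r).1 (repr r).2.

Definition is_pole r z : bool := root (rden r) z.

(* Meaningful only when [z] is not a pole of [r]. *)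
Definition reval r z : R[i] := (rnum r).[z] / (rden r).[z].

(* [size p <= n.+1] says that [p] has degree at most n (or is 0) *)
Definition ratset n : set ratfun :=
  [set r | exists p q : {poly R[i]},
    [/\ (size p <= n.+1)%N, (size q <= n.+1)%N, q != 0 & r = p%:F / q%:F]].

Definition unitary n : set ratfun :=
  [set r | ratset n r /\
    forall x : R, ~~ is_pole r (x *i) /\ cmod (reval r (x *i)) = 1].

(* On the imaginary axis [cexp (w%:C * z)] is e^(i w x) for [z = x *i]. *)
Definition exp_dist (w : R) r : \bar R :=
  inorm (fun z => if is_pole r z then +oo%E
                  else (cmod (reval r z - cexp (w%:C * z)))%:E).

(* The minimal error over [S], written as an infimum (equal to the minimum
   whenever it exists, see best_error_min). For the sets below it is finite,
   since they contain the constant function 1. *)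
Definition best_error S (w : R) : R :=
  fine (ereal_inf [set exp_dist w r | r in S]).

Definition chebyshev_error n : R -> R := best_error (ratset n).
Definition unitary_error n : R -> R := best_error (unitary n).

End RationalFunctions.

Section Facts.
Variable R : realType.
Local Notation ratfun := {fraction {poly R[i]}}.

Lemma inorm_max (absg : R[i] -> \bar R) (x0 : R) : x0 \in `[-1, 1] ->
  (forall x, x \in `[-1, 1] -> (absg (x *i) <= absg (x0 *i))%E) ->
  inorm absg = absg (x0 *i).
Proof.
move=> x01 le_x0; apply/eqP; rewrite eq_le; apply/andP; split.
  by apply: ge_ereal_sup => _ [x xI <-]; apply: le_x0.
by apply: ereal_sup_ubound; exists x0.
Qed.

Lemma best_error_min (S : set ratfun) (w : R) (r0 : ratfun) : S r0 ->
  (forall r, S r -> (exp_dist w r0 <= exp_dist w r)%E) ->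
  best_error S w = fine (exp_dist w r0).
Proof.
move=> Sr0 le_r0; congr fine; apply/eqP; rewrite eq_le; apply/andP; split.
  by apply: ereal_inf_lbound; exists r0.
by apply: le_ereal_inf_tmp => _ [r Sr <-]; apply: le_r0.
Qed.

Lemma rden_neq0 (r : ratfun) : rden r != 0.
Proof.
have d0 := denom_ratioP (repr r); rewrite /rden.
by rewrite divpN0 ?leq_gcdpr // gcdp_eq0 negb_and d0 orbT.
Qed.

Lemma coprimep_rnum_rden (r : ratfun) : coprimep (rnum r) (rden r).
Proof. by apply: coprimep_div_gcd; rewrite denom_ratioP orbT. Qed.

Lemma rnum_rdenE (r : ratfun) : r = (rnum r)%:F / (rden r)%:F.
Proof.
have d0 := denom_ratioP (repr r).
have g0 : gcdp (repr r).1 (repr r).2 != 0.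
  by rewrite gcdp_eq0 negb_and d0 orbT.
have rE : r = (repr r).1%:F / (repr r).2%:F.
  apply/(canRL (mulfK _)); first by rewrite tofrac_eq0.
  rewrite -{1}[r]reprK; unlock FracField.tofrac.
  rewrite -[LHS]FracField.pi_mul; apply/eqmodP.
  rewrite /= FracField.equivfE /FracField.mulf /=.
  by rewrite !numden_Ratio ?mulf_neq0 ?oner_neq0 // !mulr1 mulrC.
rewrite {1}rE -[X in X%:F / _](divpK (dvdp_gcdl (repr r).1 (repr r).2)).
rewrite -[X in _ / X%:F](divpK (dvdp_gcdr (repr r).1 (repr r).2)).
by rewrite !tofracM invfM mulrACA divff ?tofrac_eq0 // mulr1.
Qed.

Lemma reval_frac (p q : {poly R[i]}) (z : R[i]) : q.[z] != 0 ->
  ~~ is_pole (p%:F / q%:F) z /\ reval (p%:F / q%:F) z = p.[z] / q.[z].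
Proof.
move=> qz0; have q0 : q != 0 by apply: contraNneq qz0 => ->; rewrite horner0.
set r := _ / _; have d0 := rden_neq0 r.
have pq : p * rden r = rnum r * q.
  apply/eqP; rewrite -tofrac_eq !tofracM -eqr_div ?tofrac_eq0 //.
  by rewrite -rnum_rdenE.
have pqz : p.[z] * (rden r).[z] = (rnum r).[z] * q.[z] by rewrite -!hornerM pq.
have dz0 : ~~ is_pole r z.
  apply/negP => dz; have := coprimep_rnum_rden r.
  rewrite coprimep_sym => /coprimep_root/(_ dz)/negP; apply.
  by move/eqP: pqz; rewrite (eqP dz) mulr0 eq_sym mulf_eq0 (negPf qz0) orbF.
by split=> //; apply/eqP; rewrite /reval eqr_div // pqz.
Qed.

End Facts.

(* Main.v *)
(* Let N/D be the diagonal Pade approximant of exp of degree n, with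
   D(s) = N(-s), so that D e^s - N = kappa_n s^(2n+1) + O(s^(2n+2)).

   Upper bound: T_(2n+1)(x) = x U(x^2), and the powers w^(2(n-k)) s^(2k+1) with
   s = i w x are the leading error terms of the Pade pairs of degree k <= n,
   scaled by w^(2(n-k)). A real linear combination P of the numerators thus has
   P(s) - e^s P(-s) proportional to w^(2n+1) T_(2n+1)(x) up to O(w^(2n+2)), and
   P(s)/P(-s) is unitary since P is real.

   Lower bound: if |p - e^s q| <= e |q| on i[-w, w] with e = O(w^(2n+1)), then
   the Taylor coefficients of e^s q of orders n+1, ..., 2n are small, and this
   forces q to be q(0) (1 + O(w)), as in the Pade equations. Multiplying by D
   gives D (p - e^s q) = (D p - N q) - kappa_n q(0) s^(2n+1) + O(w^(2n+2)), where
   D p - N q has degree <= 2n, so Chebyshev's bound on the leading coefficient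
   of a polynomial of degree 2n+1 bounds e from below. *)
Require Import Defs.
From mathcomp Require Import all_boot all_order all_algebra.
From mathcomp Require Import complex.
From mathcomp Require Import all_classical all_reals all_analysis.
From mathcomp Require Import ring lra zify.

Set Implicit Arguments.
Unset Strict Implicit.
Unset Printing Implicit Defensive.

Import Order.TTheory GRing.Theory Num.Theory.
Import numFieldNormedType.Exports.

Local Open Scope classical_set_scope.
Local Open Scope ring_scope.

(** * Modulus and triangle inequalities in [R[i]] *)

Section Cmod.
Variable R : realType.
Local Open Scope complex_scope.
Implicit Types (z u v : R[i]) (x y : R).

Lemma cmodE z : `|z| = (cmod z)%:C.
Proof. by []. Qed.

Lemma cmodM u v : cmod (u * v) = cmod u * cmod v.
Proof. exact: ComplexField.Normc.normcM. Qed.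

Lemma cmodV z : cmod z^-1 = (cmod z)^-1.
Proof. exact: ComplexField.Normc.normcV. Qed.

Lemma cmod0 : cmod (0 : R[i]) = 0.
Proof. exact: ComplexField.Normc.normc0. Qed.

Lemma cmod1 : cmod (1 : R[i]) = 1.
Proof. exact: ComplexField.Normc.normc1. Qed.

Lemma cmod_ge0 z : 0 <= cmod z.
Proof. by case: z => a b; exact: sqrtr_ge0. Qed.

Lemma cmod_eq0 z : (cmod z == 0) = (z == 0).
Proof.
apply/eqP/eqP => [|->]; [exact: ComplexField.Normc.eq0_normc|exact: cmod0].
Qed.

Lemma cmod_real x : cmod x%:C = `|x|.
Proof. by rewrite /cmod /= expr0n addr0 sqrtr_sqr. Qed.

Lemma cmod_nat m : cmod (m%:R : R[i]) = m%:R.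
Proof. by rewrite -(rmorph_nat (real_complex R)) cmod_real ger0_norm. Qed.

Lemma cmod_imag x : cmod (x *i) = `|x|.
Proof. by rewrite /cmod /= expr0n add0r sqrtr_sqr. Qed.

Lemma cmodN z : cmod (- z) = cmod z.
Proof. by case: z => a b; rewrite /cmod /= !sqrrN. Qed.

Lemma cmodX z m : cmod (z ^+ m) = cmod z ^+ m.
Proof. by elim: m => [|m IH]; rewrite ?cmod1 // !exprS cmodM IH. Qed.

Lemma ler_cmodD u v : cmod (u + v) <= cmod u + cmod v.
Proof. by have := ler_normD u v; rewrite !cmodE -rmorphD lecR. Qed.

Lemma ler_cmodB u v : cmod (u - v) <= cmod u + cmod v.
Proof. by rewrite -[cmod v]cmodN ler_cmodD. Qed.

Lemma cmod_distC u v : cmod (u - v) = cmod (v - u).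
Proof. by rewrite -cmodN opprB. Qed.

Lemma ler_cmod_sum (I : Type) (s : seq I) (P : pred I) (F : I -> R[i]) :
  cmod (\sum_(i <- s | P i) F i) <= \sum_(i <- s | P i) cmod (F i).
Proof.
elim/big_ind2: _ => [|a a' b b' ha hb|//]; first by rewrite cmod0.
by apply: le_trans (ler_cmodD _ _) _; apply: lerD.
Qed.

Lemma imagE x : x *i = 'i * x%:C.
Proof. by apply/eqP; rewrite eq_complex /= !mul0r mulr0 subr0 mul1r add0r !eqxx. Qed.

Lemma cmod_le_ReIm z x : `|complex.Re z| <= x -> `|complex.Im z| <= x ->
  cmod z <= 2 * x.
Proof.
case: z => a b ha hb; have -> : a +i* b = a%:C + b *i.
  by apply/eqP; rewrite eq_complex /= addr0 add0r !eqxx.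
by apply: le_trans (ler_cmodD _ _) _; rewrite cmod_real cmod_imag /= in ha hb *; lra.
Qed.

End Cmod.

(** * The function e^(iy) and its Taylor remainder *)

Section Expi.
Variable R : realType.
Local Open Scope complex_scope.
Implicit Types (x y w : R).

Definition expi y : R[i] := cos y +i* sin y.

Lemma cexp_imag w x : cexp (w%:C * x *i) = expi (w * x).
Proof.
rewrite /cexp /= !mul0r mulr0 subr0 addr0 expR0 /expi.
by apply/eqP; rewrite eq_complex /= !mul0r !mul1r subr0 addr0 !eqxx.
Qed.

Lemma expiD x y : expi (x + y) = expi x * expi y.
Proof.
by apply/eqP; rewrite eq_complex /= cosD sinD [sin x * _ + _]addrC !eqxx.
Qed.

(** Both coefficients are read off i^k / k!, so that differentiation acts as multiplication by i and
    no case split on the parity of k arises. *)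
Definition cosT M : {poly R} := \poly_(k < M) (complex.Re ('i ^+ k) / k`!%:R).
Definition sinT M : {poly R} := \poly_(k < M) (complex.Im ('i ^+ k) / k`!%:R).

Lemma deriv_cosT M : (cosT M.+1)^`() = - sinT M.
Proof.
apply/polyP => k; rewrite coef_deriv coefN !coef_poly ltnS.
case: ltnP => _; last by rewrite mul0rn oppr0.
rewrite exprS factS natrM.
have -> : complex.Re ('i * 'i ^+ k) = - complex.Im ('i ^+ k) :> R.
  by case: ('i ^+ k) => a b /=; rewrite mul0r mul1r sub0r.
by rewrite -[LHS]mulr_natr mulrAC -mulrA invfM mulVKf ?pnatr_eq0 // mulNr.
Qed.

Lemma deriv_sinT M : (sinT M.+1)^`() = cosT M.
Proof.
apply/polyP => k; rewrite coef_deriv !coef_poly ltnS.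
case: ltnP => _; last by rewrite mul0rn.
rewrite exprS factS natrM.
have -> : complex.Im ('i * 'i ^+ k) = complex.Re ('i ^+ k) :> R.
  by case: ('i ^+ k) => a b /=; rewrite mul0r mul1r add0r.
by rewrite -[LHS]mulr_natr mulrAC -mulrA invfM mulVKf ?pnatr_eq0.
Qed.

(** One step of the remainder induction: by the mean value theorem f y = df c * y with |c| <= |y|.
    The factor 1/(M+1) that integration would yield is given up. *)
Lemma ler_norm_MVT (f df : R -> R) (M : nat) : f 0 = 0 ->
  (forall x, is_derive x 1 f (df x)) ->
  (forall x, `|df x| <= `|x| ^+ M) -> forall y, `|f y| <= `|y| ^+ M.+1.
Proof.
move=> f0 dfE dfM y.
have fc : continuous f.
  move=> x; apply: differentiable_continuous; apply/derivable1_diffP.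
  by have [] := dfE x.
have [c cy ->] : exists2 c, `|c| <= `|y| & f y = df c * y.
  have [y0|/ltW y0] := leP 0 y.
    have [c] := @MVT_segment _ f df 0 y y0 (fun x _ => dfE x)
      (continuous_subspaceT fc).
    rewrite in_itv /= => /andP[c0 cy]; rewrite f0 !subr0 => ->.
    by exists c => //; rewrite !ger0_norm // (le_trans c0).
  have [c] := @MVT_segment _ f df y 0 y0 (fun x _ => dfE x)
    (continuous_subspaceT fc).
  rewrite in_itv /= => /andP[yc c0]; rewrite f0 !sub0r => E.
  exists c; first by rewrite !ler0_norm // lerN2.
  by rewrite -[LHS]opprK E mulrN opprK.
rewrite normrM exprSr ler_wpM2r // (le_trans (dfM c)) //.
by apply: lerXn2r; rewrite // nnegrE.
Qed.

(** One induction serves both bounds, since the derivative of each remainder is, up to sign, the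
    other remainder with one term fewer. *)
Lemma cos_sin_Taylor M y :
  `|cos y - (cosT M).[y]| <= `|y| ^+ M /\ `|sin y - (sinT M).[y]| <= `|y| ^+ M.
Proof.
elim: M y => [|M IH] y.
  rewrite expr0 /cosT /sinT !poly_def !big_ord0 !horner0 !subr0.
  by split; [exact: cos_max|exact: sin_max].
have H0 (c : nat -> R) : (\poly_(k < M.+1) c k).[0] = c 0%N.
  by rewrite horner_coef0 coef_poly.
split; move: y; [
  apply: (@ler_norm_MVT _ (fun x => - (sin x - (sinT M).[x])))
| apply: (@ler_norm_MVT _ (fun x => cos x - (cosT M).[x]))].
- by rewrite H0 cos0 expr0 divr1 subrr.
- move=> x; apply: (trigger_derive (is_deriveB _ _)).
  by rewrite deriv_cosT hornerN opprK addrC opprB addrC.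
- by move=> x; rewrite normrN; case: (IH x).
- by rewrite H0 sin0 expr0 mul0r subrr.
- move=> x; apply: (trigger_derive (is_deriveB _ _)).
  by rewrite deriv_sinT.
- by move=> x; case: (IH x).
Qed.

Lemma expi_Taylor M y :
  cmod (expi y - \sum_(k < M) (y *i) ^+ k / k`!%:R) <= 2 * `|y| ^+ M.
Proof.
have -> : \sum_(k < M) (y *i) ^+ k / k`!%:R =
    (cosT M).[y] +i* (sinT M).[y] :> R[i].
  rewrite !horner_poly; elim: M => [|M IH]; first by rewrite !big_ord0.
  rewrite !big_ord_recr IH /=.
  have -> : (y *i) ^+ M / M`!%:R = 'i ^+ M * (y ^+ M / M`!%:R)%:C :> R[i].
    by rewrite imagE exprMn rmorphM rmorphXn fmorphV rmorph_nat mulrA.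
  case: ('i ^+ M) => a b.
  by apply/eqP; rewrite eq_complex /= !mulr0 subr0 add0r -!mulrA ![_^-1 * _]mulrC !eqxx.
have [h1 h2] := cos_sin_Taylor M y.
by apply: cmod_le_ReIm.
Qed.
End Expi.

(** * Chebyshev's bound on a leading coefficient *)

Section LeadCoef.
Variable R : realType.
Local Open Scope complex_scope.
Implicit Types (x y w : R).

Lemma expiX x m : expi x ^+ m = expi (m%:R * x).
Proof.
elim: m => [|m IH]; first by rewrite mul0r /expi cos0 sin0.
by rewrite exprS IH -expiD -natr1 mulrDl mul1r addrC.
Qed.

Lemma expi_mulN x : expi x * expi (- x) = 1.
Proof. by rewrite -expiD subrr /expi cos0 sin0. Qed.

Lemma expi_prim N : (0 < N)%N -> N.*2.-primitive_root (expi (pi / N%:R : R)).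
Proof.
move=> N0; rewrite /primitive_root_of_unity double_gt0 N0 /=.
have NR : N%:R != 0 :> R by rewrite pnatr_eq0 -lt0n.
apply/forallP => -[i /= iN]; rewrite unity_rootE expiX.
case: (ltngtP i.+1 N.*2) iN => // [iN _|-> _].
  (* Otherwise t in (0, 2 pi) would have cos t = 1, hence sin^2 (t/2) = 0, although 0 < t/2 < pi. *)
  rewrite eqbF_neg; apply/negP => /eqP; rewrite /expi.
  set t := _ * _ => -[ct st].
  have /andP[t0 tpi] : 0 < t / 2 < pi.
    rewrite -[t / 2 < pi]subr_gt0.
    have -> : pi - t / 2 = pi / N%:R * (N.*2%:R - i.+1%:R) / 2.
      by rewrite /t -muln2 natrM; field.
    by rewrite !(mulr_gt0, invr_gt0, pi_gt0, ltr0n, subr_gt0, ltr_nat, N0).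
  have : 0 < sin (t / 2) by apply: sin_gt0_pi; rewrite t0.
  have := cos_mulr2n (t / 2); have := sin2cos2 (t / 2).
  rewrite -[t / 2 *+ 2]mulr_natr divfK // ct => s2 c2 /(@exprn_gt0 _ 2).
  by rewrite s2 ltNge => /negP; apply; lra.
apply/eqP/eqP; have -> : N.*2%:R * (pi / N%:R) = pi *+ 2 :> R.
  by rewrite -muln2 natrM; field.
by rewrite /expi cos2pi sin2pi.
Qed.

(** With z = e^(i pi/N), 2 cos(j pi/N) = z^j + z^-j and (-1)^j = z^(N j), so the binomial expansion
    produces sums over j of z^((N+k-2l) j). Such a sum is 2N if 2N divides N+k-2l and 0 otherwise.
    As l <= k <= N, divisibility occurs only for k = N with l = 0 or l = N, hence 4N. *)
Lemma alternating_cos_moment N k : (0 < N)%N -> (k <= N)%N ->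
  \sum_(j < N.*2) (-1) ^+ j * (2 * cos (j%:R * (pi / N%:R) : R))%:C ^+ k =
  (if k == N then 4 * N%:R else 0) :> R[i].
Proof.
move=> N0 kN; have prim := expi_prim N0; set z := expi _ in prim.
have NR : N%:R != 0 :> R by rewrite pnatr_eq0 -lt0n.
have zN : z ^+ N = -1.
  rewrite expiX mulrC divfK // /expi cospi sinpi.
  by apply/eqP; rewrite eq_complex /= oppr0 !eqxx.
have sumz e : \sum_(j < N.*2) z ^+ (e * j) =
    if (N.*2 %| e)%N then N.*2%:R else 0.
  rewrite (prim_order_dvd prim); have [/eqP ze|ze] := ifPn.
    under eq_bigr do rewrite exprM ze expr1n.
    by rewrite sumr_const card_ord.
  rewrite -subr_eq0 in ze.
  apply: (mulfI ze); rewrite mulr0; under eq_bigr do rewrite exprM.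
  by rewrite -subrX1 exprAC (prim_expr_order prim) expr1n subrr.
have z0 : z != 0 by
  apply: contra_eqN zN => /eqP->; rewrite expr0n gtn_eqF // eq_sym oppr_eq0 oner_eq0.
have zV : z^-1 = expi (- (pi / N%:R)).
  by apply: (mulfI z0); rewrite mulfV // expi_mulN.
have cosz j : (2 * cos (j%:R * (pi / N%:R) : R))%:C = z ^+ j + z^-1 ^+ j.
  rewrite zV !expiX mulrN /expi cosN sinN.
  by apply/eqP; rewrite eq_complex /= subrr mulr_natl mulr2n !eqxx.
transitivity (\sum_(j < N.*2) \sum_(l < k.+1) z ^+ ((N + k - l.*2) * j) *+ 'C(k, l)).
  apply: eq_bigr => j _; rewrite cosz exprDn mulr_sumr; apply: eq_bigr => l _.
  have lk : (l <= k)%N by rewrite -ltnS.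
  rewrite mulrnAr; congr (_ *+ _); rewrite -zN.
  rewrite -!exprM mulrA -exprD exprVn.
  have -> : (N * j + j * (k - l) = (N + k - l.*2) * j + j * l)%N by nia.
  by rewrite exprD mulfK // expf_neq0.
rewrite exchange_big /=.
under eq_bigr do rewrite sumrMnl sumz.
have [->|kN'] := eqVneq k N; last first.
  rewrite big1 // => l _; rewrite ifN ?mul0rn //; apply/negP.
  by case/dvdnP=> -[|d]; have := ltn_ord l; nia.
case: N N0 {NR prim z zN z0 zV cosz sumz kN} => // N _.
rewrite big_ord_recl big_ord_recr /= big1 => [|l _].
  rewrite bin0 /bump /= add1n binn !mulr1n subn0 addnn dvdnn subnn dvdn0 add0r.
  by rewrite -muln2 natrM; ring.
rewrite ifN ?mul0rn //; apply/negP.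
by rewrite /bump /=; case/dvdnP=> -[|d]; have := ltn_ord l; nia.
Qed.

(* The functional [f |-> \sum_j (-1)^j f (cos (j pi / N))] vanishes on the
   polynomials of degree < N. *)
Lemma lead_coef_bound N (T : {poly R[i]}) w eta : (size T <= N.+2)%N ->
  0 <= w -> (forall y, `|y| <= w -> cmod T.[y *i] <= eta) ->
  cmod T`_N.+1 * w ^+ N.+1 <= 2 ^+ N * eta.
Proof.
(* The nodes w cos(j pi/(N+1)) are the extremal points of T_(N+1), scaled by w; j runs over a full
   period. *)
move=> sT w0 hT; pose th j : R := j%:R * (pi / N.+1%:R).
have : \sum_(j < N.+1.*2) (-1) ^+ j * T.[(w * cos (th j)) *i] =
  T`_N.+1 * (w *i) ^+ N.+1 / 2 ^+ N.+1 * (4 * N.+1%:R).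
  under eq_bigr do rewrite (horner_coef_wide _ sT) mulr_sumr.
  rewrite exchange_big /=.
  transitivity (\sum_(k < N.+2) T`_k * (w *i) ^+ k / 2 ^+ k *
    \sum_(j < N.+1.*2) (-1) ^+ j * (2 * cos (th j))%:C ^+ k).
    apply: eq_bigr => k _; rewrite mulr_sumr; apply: eq_bigr => j _.
    have -> : (w * cos (th j)) *i = w *i / 2 * (2 * cos (th j))%:C.
      rewrite rmorphM /= mulrA (rmorph_nat (real_complex R) 2) divfK ?pnatr_eq0 //.
      by apply/eqP; rewrite eq_complex /= !mul0r mulr0 subr0 add0r !eqxx.
    by rewrite !exprMn exprVn; ring.
  (* Only the moment of order N+1 survives, which isolates the top coefficient. *)
  rewrite big_ord_recr /= alternating_cos_moment // eqxx big1 ?add0r // => k _.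
  by rewrite alternating_cos_moment ?(ltnW (ltn_ord k)) // ltn_eqF ?mulr0.
move/(congr1 (@cmod R)); rewrite !cmodM cmodV !cmodX cmod_imag ger0_norm // => E.
rewrite !cmod_nat in E.
have : cmod (\sum_(j < N.+1.*2) (-1) ^+ j * T.[(w * cos (th j)) *i]) <=
    N.+1.*2%:R * eta.
  apply: le_trans (ler_cmod_sum _ _ _) _.
  rewrite -[N.+1.*2 in leRHS]card_ord mulr_natl -sumr_const.
  apply: ler_sum => j _; rewrite cmodM cmodX cmodN cmod1 expr1n mul1r hT //.
  by rewrite normrM ger0_norm // ler_piMr // cos_max.
rewrite E -muln2 natrM -ler_pdivlMr ?mulr_gt0 ?ltr0n // => h.
move: h; rewrite ler_pdivrMr ?exprn_gt0 //.
(* 2(N+1) terms of size eta, divided by 4(N+1) / 2^(N+1), give 2^N eta. *)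
suff -> : N.+1%:R * 2 * eta / (4 * N.+1%:R) * 2 ^+ N.+1 = 2 ^+ N * eta by [].
have N1 : N.+1%:R != 0 :> R by rewrite pnatr_eq0.
by rewrite exprS; field.
Qed.
End LeadCoef.

(** * Finite differences of binomials and reciprocals *)

Section AlternatingBinomial.
Variable F : numFieldType.

(** Pascal's rule; it drives the next two inductions, a difference of order n+1 being one of order n
    of a first difference. *)
Lemma alternating_binS n (f : nat -> F) :
  \sum_(j < n.+2) (-1) ^+ j * 'C(n.+1, j)%:R * f j =
  \sum_(j < n.+1) (-1) ^+ j * 'C(n, j)%:R * (f j - f j.+1).
Proof.
under [RHS]eq_bigr do rewrite mulrBr; rewrite sumrB.
rewrite big_ord_recl [X in _ = X - _]big_ord_recl /= !bin0 -addrA; congr (_ + _).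
rewrite [X in _ = _ - X]big_ord_recr big_ord_recr /= opprD addrA; congr (_ + _).
  rewrite -sumrB; apply: eq_bigr => j _.
  by rewrite /bump /= add1n binS natrD exprS; ring.
by rewrite /bump /= add1n !binn exprS; ring.
Qed.

(** In its upper argument, 'C(., l) has first difference 'C(., l-1); so n differences lower l by n
    and leave nothing when l < n. *)
Lemma alternating_bin_bin n d l :
  \sum_(j < n.+1) (-1) ^+ j * 'C(n, j)%:R * 'C(n + d - j, l)%:R =
  (if (n <= l)%N then 'C(d, l - n)%:R else 0) :> F.
Proof.
elim: n l => [|n IH] l.
  by rewrite big_ord_recl big_ord0 bin0 expr0 !mul1r addr0 add0n !subn0.
rewrite (alternating_binS n (fun j => 'C(n.+1 + d - j, l)%:R)).
case: l => [|l].
  by rewrite big1 // => j _; rewrite !bin0 subrr mulr0.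
rewrite subSS ltnS -IH; apply: eq_bigr => j _; congr (_ * _).
have jn : (j <= n + d)%N by rewrite (leq_trans _ (leq_addr _ _)) // -ltnS.
by rewrite addSn subSn // subSS binS natrD addrC addKr.
Qed.

(** This is the beta integral of x^a (x-1)^n over [0, 1], expanded in powers of x; the induction
    uses differences instead of integrals. *)
Lemma alternating_bin_inv n a :
  \sum_(j < n.+1) (-1) ^+ j * 'C(n, j)%:R / (n + a - j).+1%:R =
  (-1) ^+ n * (a`! * n`!)%:R / (n + a).+1`!%:R :> F.
Proof.
elim: n a => [|n IH] a.
  rewrite big_ord_recl big_ord0 bin0 expr0 addr0 add0n subn0 fact0 muln1.
  by rewrite factS natrM invfM !mul1r mulrCA mulfV ?mulr1 // pnatr_eq0 -lt0n fact_gt0.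
rewrite (alternating_binS n (fun j => (n.+1 + a - j).+1%:R^-1)).
transitivity ((-1) ^+ n * (a.+1`! * n`!)%:R / (n + a.+1).+1`!%:R -
              (-1) ^+ n * (a`! * n`!)%:R / (n + a).+1`!%:R : F).
  rewrite -!IH -sumrB; apply: eq_bigr => j _.
  by rewrite mulrBr [(n.+1 + a - j.+1)%N]subSS addSnnS.
rewrite addnS [in RHS]addSn [(n + a).+2`!]factS [(n + a).+1`!]factS.
rewrite [a.+1`!]factS [n.+1`!]factS.
have : (n + a)`!%:R != 0 :> F by rewrite pnatr_eq0 -lt0n fact_gt0.
have : (n + a).+2%:R != 0 :> F by rewrite pnatr_eq0.
have : (n + a).+1%:R != 0 :> F by rewrite pnatr_eq0.
rewrite exprS !natrM -[(n + a).+2%:R]natr1 -[(n + a).+1%:R]natr1.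
rewrite -[n.+1%:R]natr1 -[a.+1%:R]natr1 natrD.
move: (n + a)`!%:R => f h1 h2 h3; field.
by rewrite h1 h2 h3.
Qed.

End AlternatingBinomial.

(** * Truncated power series of e^z Q(z) *)

Section ExpTrunc.
Variable R : realType.
Local Open Scope complex_scope.
Implicit Types (y w : R) (P Q : {poly R[i]}).

Definition norm1 Q : R := \sum_(j < size Q) cmod Q`_j.

Lemma norm1_wide m Q : (size Q <= m)%N -> norm1 Q = \sum_(j < m) cmod Q`_j.
Proof.
move=> sQ; rewrite /norm1 (big_ord_widen _ (fun j => cmod Q`_j) sQ) big_mkcond.
by apply: eq_bigr => j _; case: ltnP => // /leq_sizeP -> //; rewrite cmod0.
Qed.

Lemma norm1_ge0 Q : 0 <= norm1 Q.
Proof. by apply: sumr_ge0 => j _; apply: cmod_ge0. Qed.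

Lemma cmod_coef_le Q j : cmod Q`_j <= norm1 Q.
Proof.
have [jQ|/leq_sizeP -> //] := ltnP j (size Q); last by rewrite cmod0 norm1_ge0.
rewrite /norm1 (bigD1 (Ordinal jQ)) //= lerDl.
by apply: sumr_ge0 => i _; apply: cmod_ge0.
Qed.

Lemma cmod_horner_le Q y : `|y| <= 1 -> cmod Q.[y *i] <= norm1 Q.
Proof.
move=> y1; rewrite horner_coef; apply: le_trans (ler_cmod_sum _ _ _) _.
apply: ler_sum => j _; rewrite cmodM cmodX cmod_imag ler_piMr ?cmod_ge0 //.
by rewrite exprn_ile1.
Qed.

Lemma cmod_hornerB_le Q y : `|y| <= 1 ->
  cmod (Q.[y *i] - Q`_0) <= norm1 Q * `|y|.
Proof.
move=> y1; rewrite (horner_coef_wide _ (leqnSn _)) (norm1_wide (leqnSn _)).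
rewrite !big_ord_recl expr0 mulr1 addrC addKr mulrDl mulr_suml.
apply: le_trans (ler_cmod_sum _ _ _) _.
rewrite ler_wpDl ?mulr_ge0 ?cmod_ge0 //; apply: ler_sum => j _.
rewrite cmodM cmodX cmod_imag ler_wpM2l ?cmod_ge0 // exprS ler_piMr //.
by rewrite exprn_ile1.
Qed.

(** Cauchy product of the exponential series with Q, cut to degree less than [M]. *)
Definition exp_mul_trunc M Q : {poly R[i]} :=
  \poly_(k < M) \sum_(j < k.+1) Q`_j / (k - j)`!%:R.

(** Regrouped by the coefficients of Q, z^j meets the exponential series cut after M-j terms, so
    each remainder has the same order M. *)
Lemma exp_mul_truncE M Q (z : R[i]) : (exp_mul_trunc M Q).[z] =
  \sum_(j < M) Q`_j * z ^+ j * \sum_(k < M - j) z ^+ k / k`!%:R.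
Proof.
rewrite horner_poly; elim: M => [|M IH]; first by rewrite !big_ord0.
rewrite big_ord_recr IH [RHS]big_ord_recr /= subSnn big_ord1 expr0 fact0 divr1.
rewrite mulr1 [in X in _ + X]big_ord_recr /= subnn fact0 divr1 mulrDl addrA.
congr (_ + _); rewrite mulr_suml -big_split; apply: eq_bigr => -[j jM] _ /=.
rewrite subSn ?(ltnW jM) // big_ord_recr /= mulrDr; congr (_ + _).
by rewrite -[in LHS](subnKC (ltnW jM)) [z ^+ (j + _)]exprD addKn; ring.
Qed.

Lemma exp_mul_trunc_rem M Q y : (size Q <= M)%N -> `|y| <= 1 ->
  cmod (expi y * Q.[y *i] - (exp_mul_trunc M Q).[y *i]) <=
  2 * norm1 Q * `|y| ^+ M.
Proof.
move=> sQ y1; rewrite exp_mul_truncE (horner_coef_wide _ sQ) mulr_sumr -sumrB.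
apply: le_trans (ler_cmod_sum _ _ _) _; rewrite (norm1_wide sQ).
rewrite mulr_sumr mulr_suml; apply: ler_sum => -[j jM] _ /=.
rewrite mulrC -mulrBr !cmodM cmodX cmod_imag.
have := expi_Taylor (M - j) y; move/(ler_wpM2l (cmod_ge0 (Q`_j))).
move/(ler_wpM2r (exprn_ge0 j (normr_ge0 y))).
rewrite mulrAC => /le_trans; apply.
rewrite -[in leRHS](subnK (ltnW jM)) exprD.
by rewrite mulrCA !mulrA.
Qed.

Lemma coef_exp_mul_trunc M Q k : (k < M)%N ->
  (exp_mul_trunc M Q)`_k = \sum_(j < k.+1) Q`_j / (k - j)`!%:R.
Proof. by move=> kM; rewrite coef_poly kM. Qed.

Lemma size_exp_mul_trunc M Q : (size (exp_mul_trunc M Q) <= M)%N.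
Proof. exact: size_poly. Qed.

End ExpTrunc.

(** * The diagonal Pade pair of exp *)

Section Pade.
Variable R : realType.
Local Open Scope complex_scope.

(** The numerator N, scaled to have constant term 1; composing with -X gives D. *)
Definition pade n : {poly R} :=
  \poly_(j < n.+1) (('C(n, j) * (2 * n - j)`!)%:R / (2 * n)`!%:R).

(** The modulus of kappa_n; its sign (-1)^n is kept apart. *)
Definition pade_const n : R := (n`!%:R) ^+ 2 / ((2 * n)`!%:R * (2 * n + 1)`!%:R).

Lemma size_pade n : (size (pade n) <= n.+1)%N.
Proof. exact: size_poly. Qed.

Lemma pade0 n : (pade n)`_0 = 1.
Proof.
by rewrite coef_poly bin0 mul1n subn0 mulfV // pnatr_eq0 -lt0n fact_gt0.
Qed.

Lemma pade_const_gt0 n : 0 < pade_const n.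
Proof. by rewrite divr_gt0 ?mulr_gt0 ?exprn_gt0 // ltr0n fact_gt0. Qed.

Lemma coef_compNX (K : comNzRingType) (p : {poly K}) j :
  (p \Po - 'X)`_j = (-1) ^+ j * p`_j.
Proof.
have E i : ((- 'X) ^+ i : {poly K})`_j = (-1) ^+ i * (j == i)%:R.
  rewrite (exprNn 'X) -signr_odd -[in RHS]signr_odd.
  by case: odd; rewrite ?(expr1, expr0, mul1r, mulN1r, coefN, coefXn).
rewrite coef_comp_poly; under eq_bigr do rewrite E.
have [jp|pj] := ltnP j (size p).
  rewrite (bigD1 (Ordinal jp)) //= eqxx mulr1 mulrC big1 ?addr0 // => i ij.
  rewrite (_ : (j == i) = false) ?mulr0 //.
  by apply: contra_neqF ij => /eqP ji; apply/val_inj.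
rewrite nth_default // mulr0 big1 // => i _.
by rewrite gtn_eqF ?mulr0 // (leq_trans (ltn_ord i)).
Qed.

(** The Pade equations. For k <= 2n, (2n-j)!/(k-j)! = (2n-k)! 'C(2n-j, 2n-k), so the sum is an n-th
    difference of a binomial. For k = 2n+1 the quotient is 1/(2n+1-j), and the n-th difference of
    reciprocals produces kappa_n. *)
Lemma coef_exp_mul_pade n k : (k <= (2 * n).+1)%N ->
  \sum_(j < k.+1) (-1) ^+ j * (pade n)`_j / (k - j)`!%:R =
  (pade n)`_k + (-1) ^+ n * pade_const n * (k == (2 * n).+1)%:R.
Proof.
move=> kn.
have fN0 m : m`!%:R != 0 :> R by rewrite pnatr_eq0 -lt0n fact_gt0.
(* D has degree at most n, so the sum can be taken over j <= n, the length required by the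
   difference formulas. *)
have -> : \sum_(j < k.+1) (-1) ^+ j * (pade n)`_j / (k - j)`!%:R =
    \sum_(j < n.+1) (if (j <= k)%N then (-1) ^+ j * (pade n)`_j / (k - j)`!%:R else 0).
  rewrite [LHS](big_ord_widen (2 * n).+2 (fun j => (-1) ^+ j * (pade n)`_j / (k - j)`!%:R)) //.
  rewrite [RHS](big_ord_widen (2 * n).+2 (fun j => if (j <= k)%N then
    (-1) ^+ j * (pade n)`_j / (k - j)`!%:R else 0)); last lia.
  rewrite big_mkcond [RHS]big_mkcond; apply: eq_bigr => j _; rewrite !ltnS.
  case: (leqP j n) => // nj; case: ifP => // _.
  by rewrite coef_poly ltnS leqNgt nj /= mulr0 mul0r.
have [->|kn'] := eqVneq k (2 * n).+1.
  rewrite coef_poly ltnS leqNgt (_ : n < (2 * n).+1)%N ?add0r; last lia.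
  transitivity ((\sum_(j < n.+1) (-1) ^+ j * 'C(n, j)%:R / (n + n - j).+1%:R) / (2 * n)`!%:R : R).
    rewrite mulr_suml; apply: eq_bigr => -[j jn] _ /=; rewrite ifT; last lia.
    rewrite coef_poly jn subSn; last lia.
    rewrite factS addnn -mul2n !natrM.
    have : (2 * n - j).+1%:R != 0 :> R by rewrite pnatr_eq0.
    by move: (fN0 (2 * n)%N) (fN0 (2 * n - j)%N); move: _%:R (_`!%:R) => *; field; apply/and3P.
  rewrite alternating_bin_inv /pade_const addnn -mul2n addn1 natrM mulr1.
  by field; rewrite !fN0.
rewrite mulr0 addr0.
have {kn'}kn : (k <= 2 * n)%N by lia.
transitivity ((2 * n - k)`!%:R / (2 * n)`!%:R *
  \sum_(j < n.+1) (-1) ^+ j * 'C(n, j)%:R * 'C(n + n - j, 2 * n - k)%:R : R).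
  rewrite mulr_sumr; apply: eq_bigr => -[j jn] _ /=; rewrite addnn -mul2n.
  case: leqP => jk; last by rewrite (@bin_small (2 * n - j)) ?mulr0 //; lia.
  rewrite coef_poly jn natrM.
  have <- : ('C(2 * n - j, 2 * n - k) * ((2 * n - k)`! * (k - j)`!) = (2 * n - j)`!)%N.
    rewrite (_ : (k - j = 2 * n - j - (2 * n - k))%N); last lia.
    by rewrite bin_fact //; lia.
  rewrite !natrM; move: (fN0 (2 * n)%N) (fN0 (k - j)%N) => h1 h2.
  by field; rewrite h1.
rewrite alternating_bin_bin coef_poly ltnS.
have -> : (n <= 2 * n - k)%N = (k <= n)%N by lia.
case: leqP => kn'; last by rewrite mulr0.
rewrite (_ : (2 * n - k - n = n - k)%N); last lia.
by rewrite bin_sub // natrM; ring.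
Qed.

Definition cpade n : {poly R[i]} := map_poly (real_complex R) (pade n).

Lemma exp_mul_trunc_pade n :
  exp_mul_trunc (2 * n).+2 (cpade n \Po - 'X) =
  cpade n + ((-1) ^+ n * pade_const n)%:C *: 'X ^+ (2 * n).+1.
Proof.
apply/polyP => k; rewrite coefD coefZ coefXn coef_map /=.
have [kn|kn] := leqP k (2 * n).+1; last first.
  rewrite !nth_default ?(leq_trans _ kn) ?size_exp_mul_trunc ?(leq_trans (size_pade _)) //; last lia.
  by rewrite gtn_eqF // mulr0 rmorph0 addr0.
rewrite coef_exp_mul_trunc //.
rewrite -(rmorph_nat (real_complex R) (k == _)) -rmorphM -rmorphD -coef_exp_mul_pade //.
rewrite rmorph_sum; apply: eq_bigr => j _.
by rewrite coef_compNX coef_map /= fmorph_div !rmorphM rmorphXn rmorphN1 rmorph_nat.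
Qed.
End Pade.

(** * Lower bound for polynomial pairs on i[-w, w] *)

Section LowerBound.
Variable R : realType.
Local Open Scope complex_scope.
Implicit Types (P Q : {poly R[i]}) (w e : R).

(** Differencing in x removes c_0 and shifts the other coefficients down, at the price of one sample
    and a doubled bound; c_0 is then read off at x0. The constant depends on n and x0 only. *)
Lemma newton_coef_bound n x0 : exists2 C : R, 0 <= C &
  forall (c : nat -> R[i]) (delta : R),
  (forall x, (x0 <= x < x0 + n)%N ->
    cmod (\sum_(j < n) c j * 'C(x, j)%:R) <= delta) ->
  forall j, (j < n)%N -> cmod (c j) <= C * delta.
Proof.
elim: n => [|n [C C0 IH]]; first by exists 0.
pose S : R := \sum_(j < n) 'C(x0, j.+1)%:R.
have S0 : 0 <= S by apply: sumr_ge0.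
exists (1 + 2 * C + 2 * C * S); first by rewrite !addr_ge0 ?mulr_ge0.
move=> c delta hc.
have d0 : 0 <= delta.
  by apply: le_trans (cmod_ge0 _) (hc x0 _); rewrite leqnn addnS ltnS leq_addr.
have cS j : (j < n)%N -> cmod (c j.+1) <= 2 * C * delta.
  move=> jn; rewrite -mulrA mulrCA.
  apply: (IH (fun j => c j.+1) (2 * delta)) jn => x /andP[x0x xn].
  have -> : \sum_(j < n) c j.+1 * 'C(x, j)%:R =
      \sum_(j < n.+1) c j * 'C(x.+1, j)%:R - \sum_(j < n.+1) c j * 'C(x, j)%:R.
    rewrite -sumrB big_ord_recl !bin0 subrr add0r; apply: eq_bigr => i _.
    by rewrite -mulrBr binS natrD addrC addKr.
  apply: le_trans (ler_cmodB _ _) _.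
  by rewrite mulr_natl mulr2n lerD // hc //; apply/andP; split; lia.
case=> [|j] jn; last first.
  apply: le_trans (cS j jn) _; rewrite ler_wpM2r // -addrA addrCA lerDl.
  by rewrite addr_ge0 ?mulr_ge0.
have := hc x0; rewrite leqnn addnS ltnS leq_addr => /(_ isT).
rewrite big_ord_recl bin0 mulr1; set s := \sum_(i < _) _ => hs.
have sE : cmod s <= 2 * C * delta * S.
  apply: le_trans (ler_cmod_sum _ _ _) _; rewrite mulr_sumr.
  by apply: ler_sum => i _; rewrite cmodM cmod_nat ler_wpM2r // cS.
rewrite -[c 0%N](addrK s); apply: le_trans (ler_cmodB _ _) _.
apply: le_trans (lerD hs sE) _.
have : 0 <= C * delta by rewrite mulr_ge0.
by rewrite !mulrDl; lra.
Qed.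

(* For n < m <= 2n the coefficient of z^m in exp z * Q(z) is small. As
   (m-1)!/(m-j)! = (j-1)! 'C(m-1, j-1), these n conditions give the values at
   m-1 = n, ..., 2n-1 of a polynomial whose Newton coefficients are the
   (j-1)! Q_j for 0 < j <= n, up to an error controlled by Q_0. *)
Lemma denom_bound n (a : R) : 0 <= a -> exists2 A : R, 0 <= A &
  exists2 d : R, 0 < d <= 1 &
  forall w e P Q, 0 < w < d -> 0 <= e <= a * w ^+ (2 * n).+1 ->
  (size P <= n.+1)%N -> (size Q <= n.+1)%N ->
  (forall y, `|y| <= w ->
    cmod (P.[y *i] - expi y * Q.[y *i]) <= e * cmod Q.[y *i]) ->
  norm1 Q <= A * cmod Q`_0.
Proof.
move=> a0; have [C C0 hC] := newton_coef_bound n n.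
(* 4^n bounds the Chebyshev factor 2^m for m < 2n; the 2 comes from the Taylor remainder and [a]
   from the assumed error. *)
pose C1 : R := 4 ^+ n * (2 + a).
pose C3 : R := n%:R * (C * (2 * n)`!%:R).
have C10 : 0 <= C1 by rewrite mulr_ge0 ?exprn_ge0 ?addr_ge0.
have C30 : 0 <= C3 by rewrite !mulr_ge0.
exists (2 * (1 + C3)); first by rewrite mulr_ge0 ?addr_ge0.
have D0 : 0 < 2 * (1 + C3 * C1) by rewrite mulr_gt0 // ltr_pwDl // mulr_ge0.
(* Then C3 * C1 * w <= 1/2, so the term C3 * C1 * B * w is absorbed by B in the final inequality. *)
exists (2 * (1 + C3 * C1))^-1.
  rewrite invr_gt0 D0 invf_le1 //.
  by have := mulr_ge0 C30 C10; lra.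
move=> w e P Q /andP[w0 wd] /andP[e0 ea] sP sQ hPQ.
have w1 : w <= 1.
  apply: le_trans (ltW wd) _; rewrite invf_le1 //.
  by have := mulr_ge0 C30 C10; lra.
set B := norm1 Q; have B0 : 0 <= B by apply: norm1_ge0.
have wd' : w * (2 * (1 + C3 * C1)) <= 1.
  by rewrite -ler_pdivlMr // mul1r ltW.
pose ga m := \sum_(j < m.+1) Q`_j / (m - j)`!%:R.
have gaB m : (n <= m < n + n)%N -> cmod (ga m.+1) <= C1 * B * w.
  move=> /andP[nm mn].
  (* [P] has degree at most n <= m, so the coefficient of order m+1 is that of e^z Q. *)
  pose T := exp_mul_trunc m.+2 Q - P.
  have sT : (size T <= m.+2)%N.
    rewrite (leq_trans (size_polyD _ _)) // geq_max size_exp_mul_trunc size_polyN.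
    by rewrite (leq_trans sP) // ltnS (leq_trans nm).
  have TE : T`_m.+1 = ga m.+1.
    by rewrite coefB coef_exp_mul_trunc // [P`_ _]nth_default ?subr0 // (leq_trans sP).
  have := lead_coef_bound (eta := (2 + a) * B * w ^+ m.+2) sT (ltW w0).
  rewrite TE => h.
  have {}h : cmod (ga m.+1) * w ^+ m.+1 <= 2 ^+ m * ((2 + a) * B * w ^+ m.+2).
    apply: h => y yw; have y1 := le_trans yw w1.
    have -> : T.[y *i] = - (expi y * Q.[y *i] - (exp_mul_trunc m.+2 Q).[y *i]) -
        (P.[y *i] - expi y * Q.[y *i]) by rewrite hornerD hornerN; ring.
    apply: le_trans (ler_cmodB _ _) _; rewrite cmodN.
    have sQ' : (size Q <= m.+2)%N by rewrite (leq_trans sQ) // ltnS ltnW.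
    apply: le_trans (lerD (exp_mul_trunc_rem sQ' y1) (hPQ y yw)) _.
    rewrite [in leRHS]mulrDl [in leRHS]mulrDl lerD //.
      rewrite ler_wpM2l ?mulr_ge0 //; apply: lerXn2r => //; rewrite nnegrE //; exact: ltW.
    rewrite mulrAC; apply: ler_pM => //; rewrite ?cmod_ge0 //; last exact: cmod_horner_le.
    apply: le_trans ea _; rewrite ler_wpM2l //.
    by apply: ler_wiXn2l; [exact: ltW|exact: w1|move: mn; clear; lia].
  rewrite -(ler_pM2r (exprn_gt0 m.+1 w0)); apply: le_trans h _.
  have -> : C1 * B * w * w ^+ m.+1 = 4 ^+ n * ((2 + a) * B * w ^+ m.+2).
    by rewrite /C1 [w ^+ m.+2]exprS; ring.
  apply: ler_wpM2r.
    by apply: mulr_ge0 (exprn_ge0 _ (ltW w0)); rewrite mulr_ge0 ?addr_ge0.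
  have -> : 4 = 2 ^+ 2 :> R by rewrite expr2; ring.
  by rewrite -exprM; apply: ler_weXn2l; [rewrite ler1n|move: mn; clear; lia].
have Qj j : (j < n)%N -> cmod Q`_j.+1 <= C * ((2 * n)`!%:R * (C1 * B * w + cmod Q`_0)).
  move=> jn; have fc m : 1 <= (m`!%:R : R) by rewrite ler1n fact_gt0.
  (* As j! >= 1, it suffices to bound the Newton coefficient j! Q_(j+1). *)
  apply: (@le_trans _ _ (cmod (Q`_j.+1 * j`!%:R))).
    by rewrite cmodM cmod_nat ler_peMr ?cmod_ge0.
  apply: (hC (fun j => Q`_j.+1 * j`!%:R)) jn => x xn.
  have -> : \sum_(i < n) Q`_i.+1 * i`!%:R * 'C(x, i)%:R =
      x`!%:R * (ga x.+1 - Q`_0 / x.+1`!%:R).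
    rewrite /ga big_ord_recl subn0 addrC addKr mulr_sumr.
    rewrite (big_ord_widen x.+1 (fun i => Q`_i.+1 * i`!%:R * 'C(x, i)%:R)); last by case/andP: xn => /leqW.
    rewrite big_mkcond; apply: eq_bigr => -[i ix] _ /=; rewrite /bump /= add1n.
    case: ltnP => ni; last by rewrite nth_default ?mul0r ?mulr0 // (leq_trans sQ).
    rewrite subSS -(bin_fact (_ : i <= x)%N) // !natrM.
    have fx : (x - i)`!%:R != 0 :> R[i] by rewrite pnatr_eq0 -lt0n fact_gt0.
    by field.
  rewrite cmodM cmod_nat ler_pM ?cmod_ge0 //.
    by rewrite ler_nat; apply: leq_fact; move: xn; clear; lia.
  apply: le_trans (ler_cmodB _ _) _; rewrite lerD ?gaB //.
  rewrite cmodM cmodV cmod_nat ler_pdivrMr ?ltr0n ?fact_gt0 //.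
  by rewrite ler_peMr ?cmod_ge0.
have : B <= cmod Q`_0 + C3 * (C1 * B * w + cmod Q`_0).
  have BE : B = cmod Q`_0 + \sum_(j < n) cmod Q`_j.+1.
    by rewrite /B (norm1_wide sQ) big_ord_recl.
  rewrite {1}BE lerD2l.
  apply: (@le_trans _ _ (\sum_(j < n) C * ((2 * n)`!%:R * (C1 * B * w + cmod Q`_0)))).
    by apply: ler_sum => j _; exact: Qj.
  by rewrite sumr_const card_ord -[leLHS]mulr_natl /C3 !mulrA.
have := cmod_ge0 Q`_0; have := mulr_ge0 C30 (cmod_ge0 Q`_0).
have := ler_wpM2l B0 wd'; have := mulr_ge0 B0 (ltW w0).
by rewrite -/B; lra.
Qed.

Lemma cpade_size n : (size (cpade R n) <= n.+1)%N.
Proof. by rewrite (leq_trans (size_poly _ _)) // size_pade. Qed.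

Lemma cpadeN_size n : (size (cpade R n \Po - 'X) <= n.+1)%N.
Proof. by rewrite size_comp_poly2 ?cpade_size // size_polyN size_polyX. Qed.

Lemma cpadeN0 n : (cpade R n \Po - 'X)`_0 = 1.
Proof. by rewrite coef_compNX expr0 mul1r coef_map /= pade0. Qed.

Lemma cpade_rem n y : `|y| <= 1 ->
  cmod (expi y * (cpade R n \Po - 'X).[y *i] - (cpade R n).[y *i] -
        ((-1) ^+ n * pade_const R n)%:C * (y *i) ^+ (2 * n).+1) <=
  2 * norm1 (cpade R n \Po - 'X) * `|y| ^+ (2 * n).+2.
Proof.
move=> y1; have sq : (size (cpade R n \Po - 'X) <= (2 * n).+2)%N.
  by rewrite (leq_trans (cpadeN_size n)) // mul2n -addnn ltnS leqW // leq_addr.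
have := exp_mul_trunc_rem sq y1.
by rewrite exp_mul_trunc_pade hornerD hornerZ hornerXn opprD addrA.
Qed.

Lemma size_polyM_leq (K : nzSemiRingType) (p q : {poly K}) n :
  (size p <= n.+1)%N -> (size q <= n.+1)%N -> (size (p * q)%R <= (2 * n).+1)%N.
Proof.
move=> sp sq; rewrite (leq_trans (size_polyMleq _ _)) //.
by rewrite -subn1 leq_subLR (leq_trans (leq_add sp sq)) // mul2n -addnn addnS.
Qed.

(** The upper bound on e feeds [denom_bound] and makes e times any O(w) factor of order w^(2n+2). *)
Lemma chebyshev_lower n : exists2 K : R, 0 <= K & exists2 d : R, 0 < d <= 1 &
  forall w e P Q, 0 < w < d ->
  0 <= e <= pade_const R n / 4 ^+ n * w ^+ (2 * n).+1 ->
  (size P <= n.+1)%N -> (size Q <= n.+1)%N -> Q != 0 ->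
  (forall y, `|y| <= w ->
    cmod (P.[y *i] - expi y * Q.[y *i]) <= e * cmod Q.[y *i]) ->
  pade_const R n / 4 ^+ n * w ^+ (2 * n).+1 - K * w ^+ (2 * n).+2 <= e.
Proof.
set k := pade_const R n; set c := k / 4 ^+ n.
have k0 : 0 < k := pade_const_gt0 R n.
have c0 : 0 < c by rewrite divr_gt0 ?exprn_gt0.
have [A A0 [d d01 hA]] := denom_bound n (ltW c0).
set q := cpade R n \Po - 'X; set p := cpade R n.
pose D := 2 * norm1 q; have D0 : 0 <= D by rewrite mulr_ge0 ?norm1_ge0.
exists (c * (D + A + D * A) + (k + D) * A).
  by do !(apply: addr_ge0 || apply: mulr_ge0) => //; apply: ltW.
exists d => // w e P Q wd /[dup] ec /andP[e0 ec'] sP sQ Q0 hPQ.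
have QA := hA w e P Q wd ec sP sQ hPQ.
have /andP[w0 wd'] := wd; have w1 : w <= 1.
  by case/andP: d01 => _; apply: le_trans; exact: ltW.
(* By [denom_bound], Q(0) = 0 would make all coefficients of Q vanish. *)
set b := cmod Q`_0 in QA; have b0 : 0 < b.
  rewrite lt_neqAle cmod_ge0 andbT; apply: contra_neq Q0 => b0.
  move: QA; rewrite -b0 mulr0 => n0; apply/polyP => j; rewrite coef0.
  by apply/eqP; rewrite -cmod_eq0 eq_le cmod_ge0 (le_trans (cmod_coef_le Q j)).
pose s := ((-1) ^+ n * k)%:C : R[i].
have cs : cmod s = k by rewrite cmod_real normrM normrX normrN1 expr1n mul1r ger0_norm // ltW.
(* [s] is kappa_n. Both products have degree at most 2n, so the coefficient of order 2n+1 comes from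
   the added monomial alone. *)
pose T := q * P - p * Q + (- (s * Q`_0)) *: 'X ^+ (2 * n).+1.
have sqP : (size (q * P)%R <= (2 * n).+1)%N.
  exact: size_polyM_leq (cpadeN_size n) sP.
have spQ : (size (p * Q)%R <= (2 * n).+1)%N.
  exact: size_polyM_leq (cpade_size n) sQ.
have sT : (size T <= (2 * n).+2)%N.
  rewrite (leq_trans (size_polyD _ _)) // geq_max; apply/andP; split.
    rewrite (leq_trans (size_polyD _ _)) // geq_max size_polyN.
    by rewrite (leqW sqP) (leqW spQ).
  by rewrite (leq_trans (size_scale_leq _ _)) // size_polyXn.
have TE : cmod T`_(2 * n).+1 = k * b.
  rewrite coefD coefB coefZ coefXn eqxx mulr1 (nth_default _ sqP) (nth_default _ spQ) subr0 add0r.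
  by rewrite cmodN cmodM cs.
pose eta := b * (e * (1 + D * w) * (1 + A * w) + (k + D) * A * w ^+ (2 * n).+2).
have : cmod T`_(2 * n).+1 * w ^+ (2 * n).+1 <= 2 ^+ (2 * n) * eta.
  apply: lead_coef_bound => //; first exact: ltW.
  move=> y yw; have y1 := le_trans yw w1.
  pose r := expi y * q.[y *i] - p.[y *i] - s * (y *i) ^+ (2 * n).+1.
  have hr : cmod r <= D * w ^+ (2 * n).+2.
    apply: le_trans (cpade_rem n y1) _; rewrite ler_wpM2l //.
    by apply: lerXn2r; rewrite ?nnegrE ?(ltW w0).
  (* The three terms are the assumed error, the variation of Q around Q(0) and the Pade remainder;
     relative to |Q(0)|, the last two are O(w^(2n+2)). *)
  have -> : T.[y *i] = q.[y *i] * (P.[y *i] - expi y * Q.[y *i]) +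
      (s * (y *i) ^+ (2 * n).+1 * (Q.[y *i] - Q`_0) + r * Q.[y *i]).
    by rewrite /T !(hornerD, hornerN, hornerM, hornerZ, hornerXn) /r; ring.
  have hQ0 : cmod (Q.[y *i] - Q`_0) <= A * b * w.
    apply: le_trans (cmod_hornerB_le _ y1) _.
    by apply: ler_pM => //; exact: norm1_ge0.
  have hQ : cmod Q.[y *i] <= b * (1 + A * w).
    rewrite -[Q.[_]](subrK Q`_0) addrC; apply: le_trans (ler_cmodD _ _) _.
    by rewrite mulrDr mulr1 lerD2l mulrA [b * A]mulrC.
  have hq : cmod q.[y *i] <= 1 + D * w.
    rewrite -[q.[_]](subrK q`_0) addrC; apply: le_trans (ler_cmodD _ _) _.
    rewrite [X in cmod X](cpadeN0 n) cmod1 lerD2l; apply: le_trans (cmod_hornerB_le _ y1) _.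
    by apply: ler_pM; rewrite ?norm1_ge0 // /D; have := norm1_ge0 q; lra.
  apply: le_trans (ler_cmodD _ _) _; rewrite /eta [leRHS]mulrDr lerD //.
    rewrite cmodM; apply: le_trans (ler_wpM2l (cmod_ge0 _) (hPQ y yw)) _.
    have -> : b * (e * (1 + D * w) * (1 + A * w)) =
      e * ((1 + D * w) * (b * (1 + A * w))) by ring.
    rewrite mulrCA; apply: ler_wpM2l => //.
    by apply: ler_pM; rewrite ?cmod_ge0.
  apply: le_trans (ler_cmodD _ _) _; rewrite !cmodM cs cmodX cmod_imag.
  rewrite [(k + D) * A]mulrDl [in leRHS]mulrDl [leRHS]mulrDr lerD //.
    have -> : b * (k * A * w ^+ (2 * n).+2) = k * w ^+ (2 * n).+1 * (A * b * w).
      by rewrite exprS; ring.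
    apply: ler_pM; rewrite ?mulr_ge0 ?exprn_ge0 ?cmod_ge0 ?(ltW k0) //.
    rewrite ler_wpM2l ?(ltW k0) //.
    by apply: lerXn2r; rewrite ?nnegrE ?(ltW w0).
  have -> : b * (D * A * w ^+ (2 * n).+2) = D * w ^+ (2 * n).+2 * (A * b) by ring.
  apply: ler_pM; rewrite ?cmod_ge0 //.
  by apply: le_trans (cmod_horner_le _ y1) QA.
have -> : 2 ^+ (2 * n) = 4 ^+ n :> R.
  by rewrite exprM; congr (_ ^+ _); rewrite expr2; ring.
rewrite TE /eta [w ^+ (2 * n).+2]exprS.
set W := w ^+ (2 * n).+1 in ec ec' *.
have W0 : 0 <= W by rewrite exprn_ge0 // ltW.
have -> : k * b * W = 4 ^+ n * (b * (c * W)).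
  have -> : k = c * 4 ^+ n by rewrite divfK // expf_neq0 // pnatr_eq0.
  by ring.
rewrite ler_pM2l ?exprn_gt0 // ler_pM2l // => h.
(* The excess of (1 + D w)(1 + A w) over 1 multiplies e <= c W, hence goes into K w^(2n+2). *)
have : e * (w * (D + A + D * A * w)) <= c * W * (w * (D + A + D * A)).
  have DA : 0 <= D * A by rewrite mulr_ge0.
  apply: ler_pM => //; first by do !(apply: addr_ge0 || apply: mulr_ge0) => //; exact: ltW.
  rewrite ler_wpM2l ?(ltW w0) // lerD2l -[leRHS]mulr1.
  by apply: ler_wpM2l.
by move: h; lra.
Qed.

End LowerBound.

(** * A near-optimal pair with real coefficients *)

Section UpperBound.
Variable R : realType.
Local Open Scope complex_scope.
Implicit Types (P Q : {poly R[i]}) (w : R).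

Lemma imag_exprS (y : R) k :
  (y *i) ^+ (2 * k).+1 = ((-1) ^+ k * y ^+ (2 * k).+1) *i.
Proof.
elim: k => [|k IH]; first by rewrite muln0 !expr1 mul1r.
have -> : (2 * k.+1).+1 = (2 * k).+3 by lia.
rewrite exprS exprS IH; apply/eqP; rewrite eq_complex /=.
by rewrite !exprS; apply/andP; split; apply/eqP; ring.
Qed.

(** The recurrence T_(m+2) = (4x^2 - 2) T_m - T_(m-2) stays among odd indices, so u is multiplied by
    4X - 2 and the previous u subtracted. The induction therefore carries two consecutive
    polynomials. *)
Lemma odd_chebyshev n : exists u : {poly R},
  [/\ (size u <= n.+1)%N, u`_n = 4 ^+ n &
      forall t, cos t * u.[cos t ^+ 2] = cos ((2 * n).+1%:R * t)].
Proof.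
pose good m (u : {poly R}) := [/\ (size u <= m.+1)%N, u`_m = 4 ^+ m &
      forall t, cos t * u.[cos t ^+ 2] = cos ((2 * m).+1%:R * t)].
have cos_rec (a t : R) : cos (a + 2 * t) = (4 * cos t ^+ 2 - 2) * cos a - cos (a - 2 * t).
  have -> : 2 * t = t *+ 2 by rewrite mulr_natl.
  by rewrite cosB cosD cos_mulr2n -[_ *+ 2]mulr_natl; ring.
suff [u [v [hu _]]] : exists u v, good n u /\ good n.+1 v by exists u.
elim: n => [|n [u [v [[su un hu] hv]]]].
  exists 1, (4 *: 'X - 3%:P); split; split.
  - by rewrite size_poly1.
  - by rewrite coef1 expr0.
  - by move=> t; rewrite hornerC mulr1 muln0 mul1r.
  - rewrite (leq_trans (size_polyD _ _)) // geq_max size_polyN.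
    by rewrite (leq_trans (size_scale_leq _ _)) ?size_polyX // (leq_trans (size_polyC_leq1 _)).
  - by rewrite coefB coefZ coefX coefC subr0 mulr1 expr1.
  - move=> t; rewrite hornerD hornerN hornerZ hornerX hornerC -[(2 * 1).+1]/3%N.
    have -> : 3%:R * t = t + 2 * t by ring.
    rewrite cos_rec; have -> : t - 2 * t = - t by ring.
    by rewrite cosN; ring.
case: (hv) => sv vn hv'.
exists v, ((4 *: 'X - 2%:P) * v - u); split => //; split.
- rewrite (leq_trans (size_polyD _ _)) // geq_max size_polyN.
  rewrite (leq_trans su) ?andbT; last by rewrite ltnW.
  rewrite (leq_trans (size_polyMleq _ _)) //.
  have s2 : (size (4 *: 'X - 2%:P : {poly R})%R <= 2)%N.
    rewrite (leq_trans (size_polyD _ _)) // geq_max size_polyN.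
    by rewrite (leq_trans (size_scale_leq _ _)) ?size_polyX // (leq_trans (size_polyC_leq1 _)).
  by rewrite -subn1 leq_subLR (leq_trans (leq_add s2 sv)).
- rewrite coefB mulrBl coefB -scalerAl coefZ coefXM /= vn coefCM.
  rewrite [v`_n.+2]nth_default // mulr0 subr0 [u`__]nth_default ?subr0.
    by rewrite [in RHS]exprS.
  by rewrite (leq_trans su) // ltnW.
- move=> t; rewrite hornerD hornerN hornerM mulrBr mulrCA hv' hu hornerD hornerN hornerZ hornerX hornerC.
  have -> : (2 * n.+2).+1%:R * t = (2 * n.+1).+1%:R * t + 2 * t.
    by rewrite -mulrDl -natrD; congr (_%:R * _); lia.
  rewrite cos_rec; congr (_ - cos _).
  rewrite -mulrBl; congr (_ * _).
  have -> : ((2 * n.+1).+1 = (2 * n).+1 + 2)%N by lia.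
  by rewrite natrD addrK.
Qed.

Lemma chebyshev_upper n : exists2 K : R, 0 <= K & exists2 d : R, 0 < d <= 1 &
  forall w, 0 < w < d -> exists H : {poly R}, (size H <= n.+1)%N /\
  let P := map_poly (real_complex R) H in
  forall y, `|y| <= w -> (P \Po - 'X).[y *i] != 0 /\
    cmod (P.[y *i] / (P \Po - 'X).[y *i] - expi y) <=
    pade_const R n / 4 ^+ n * w ^+ (2 * n).+1 + K * w ^+ (2 * n).+2.
Proof.
set c := pade_const R n / 4 ^+ n.
have c0 : 0 < c by rewrite divr_gt0 ?pade_const_gt0 ?exprn_gt0.
have [u [su un hu]] := odd_chebyshev n.
(* This weight turns the leading error coefficient of the degree-k pair into c u_k, up to a sign
   (-1)^k that i^(2k+1) cancels. The weight for k = n is 1, which makes the denominator 1 + O(w). *)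
pose la k := c * u`_k / pade_const R k.
have kN0 k : pade_const R k != 0 by rewrite gt_eqF ?pade_const_gt0.
have lan : la n = 1.
  have h4 : 4 ^+ n != 0 :> R by rewrite expf_neq0 // pnatr_eq0.
  by rewrite /la un /c (divfK h4) divff.
pose q k := cpade R k \Po - 'X.
(* K1 collects the Pade remainders, K2 the deviation of the denominator from 1. *)
pose K1 : R := \sum_(k < n.+1) `|la k| * (2 * norm1 (q k)).
pose K2 : R := \sum_(k < n.+1) `|la k| * norm1 (q k).
have K20 : 0 <= K2 by apply: sumr_ge0 => k _; rewrite mulr_ge0 ?norm1_ge0.
have K10 : 0 <= K1 by apply: sumr_ge0 => k _; rewrite !mulr_ge0 ?norm1_ge0.
exists (2 * (K1 + c * K2)); first by rewrite mulr_ge0 ?addr_ge0 // mulr_ge0 // ltW.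
have D0 : 0 < 2 * (1 + K2) by rewrite mulr_gt0 // ltr_pwDl.
(* This gives w K2 <= 1/2 and keeps the denominator away from 0. *)
exists (2 * (1 + K2))^-1; first by rewrite invr_gt0 D0 invf_le1 //; lra.
move=> w /andP[w0 wd].
have w1 : w <= 1 by apply: le_trans (ltW wd) _; rewrite invf_le1 //; lra.
have wd' : w * K2 <= 1 / 2.
  have : w * (2 * (1 + K2)) <= 1 by rewrite -ler_pdivlMr // mul1r ltW.
  by rewrite mulrCA mulrDr; lra.
exists (\sum_(k < n.+1) (la k * w ^+ (2 * (n - k))) *: pade R k); split.
  rewrite (leq_trans (size_sum _ _ _)) //; apply/bigmax_leqP => -[k kn] _.
  by rewrite (leq_trans (size_scale_leq _ _)) // (leq_trans (size_pade _ _)).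
move=> P y yw; have y1 := le_trans yw w1.
pose la' k : R[i] := (la k * w ^+ (2 * (n - k)))%:C.
have PE z : P.[z] = \sum_(k < n.+1) la' k * (cpade R k).[z].
  rewrite /P rmorph_sum horner_sum; apply: eq_bigr => k _.
  by rewrite /= map_polyZ hornerZ.
have QE z : (P \Po - 'X).[z] = \sum_(k < n.+1) la' k * (q k).[z].
  by rewrite horner_comp PE; apply: eq_bigr => k _; rewrite horner_comp.
set Q := (P \Po - 'X).[y *i]; set W := w ^+ (2 * n).+1.
have W0 : 0 <= W by rewrite exprn_ge0 // ltW.
have cla k : cmod (la' k) = `|la k| * w ^+ (2 * (n - k)).
  by rewrite cmod_real normrM [`|_ ^+ _|]ger0_norm // exprn_ge0 // ltW.
have hQ : cmod (Q - 1) <= K2 * w.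
  rewrite /Q QE /K2 big_ord_recr [in leRHS]big_ord_recr /= mulrDl lan normr1 mul1r -addrA.
  apply: le_trans (ler_cmodD _ _) _; apply: lerD.
    apply: le_trans (ler_cmod_sum _ _ _) _; rewrite mulr_suml.
    apply: ler_sum => -[k kn] _ /=; rewrite cmodM cla -!mulrA.
    rewrite ler_wpM2l // mulrC; apply: ler_pM; rewrite ?cmod_ge0 ?exprn_ge0 ?(ltW w0) //.
      exact: cmod_horner_le.
    rewrite -[leRHS]expr1; apply: ler_wiXn2l; rewrite ?(ltW w0) //.
    by rewrite muln_gt0 subn_gt0.
  have -> : la' n = 1 by rewrite /la' lan subnn muln0 mulr1.
  rewrite mul1r -[1 in X in cmod X](cpadeN0 R n).
  apply: le_trans (cmod_hornerB_le _ y1) _.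
  by rewrite ler_wpM2l ?norm1_ge0.
have Q1 : 1 - K2 * w <= cmod Q.
  have : cmod 1 <= cmod Q + cmod (Q - 1).
    rewrite cmod_distC; apply: le_trans (ler_cmodD _ _).
    by rewrite addrC subrK.
  by rewrite cmod1; lra.
have Q0 : Q != 0 by rewrite -cmod_eq0 gt_eqF //; lra.
split=> //.
(* The sum is c W T_(2n+1)(y/w), and y/w is a cosine because |y| <= w. *)
have hcheb : `|\sum_(k < n.+1) c * u`_k * w ^+ (2 * (n - k)) * y ^+ (2 * k).+1| <= c * W.
  pose x := y / w; have x1 : -1 <= x <= 1.
    by rewrite -ler_norml normrM normfV [`|w|]ger0_norm ?(ltW w0) // ler_pdivrMr // mul1r.
  have -> : \sum_(k < n.+1) c * u`_k * w ^+ (2 * (n - k)) * y ^+ (2 * k).+1 =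
      c * W * (x * u.[x ^+ 2]).
    rewrite (horner_coef_wide _ su) !mulr_sumr; apply: eq_bigr => -[k kn] _ /=.
    have -> : y = x * w by rewrite divfK // gt_eqF.
    rewrite /W (_ : (2 * n).+1 = 2 * (n - k) + (2 * k).+1)%N.
      by rewrite -exprM exprMn exprD exprS; ring.
    by move: kn; clear; lia.
  have xE : cos (acos x) = x by rewrite acosK // in_itv.
  rewrite -xE hu normrM ger0_norm ?mulr_ge0 ?(ltW c0) //.
  by rewrite ler_piMr ?cos_max // mulr_ge0 // ltW.
have hnum : cmod (P.[y *i] - expi y * Q) <= c * W + K1 * (w * W).
  pose rho k := expi y * (q k).[y *i] - (cpade R k).[y *i] -
        ((-1) ^+ k * pade_const R k)%:C * (y *i) ^+ (2 * k).+1.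
  have -> : P.[y *i] - expi y * Q =
     - ((\sum_(k < n.+1) c * u`_k * w ^+ (2 * (n - k)) * y ^+ (2 * k).+1) *i
     + \sum_(k < n.+1) la' k * rho k).
    rewrite [(\sum_(k < _) _) *i]imagE rmorph_sum mulr_sumr -big_split /=
      PE /Q QE mulr_sumr -sumrB -sumrN.
    apply: eq_bigr => k _; rewrite -imagE.
    have -> : (c * u`_k * w ^+ (2 * (n - k)) * y ^+ (2 * k).+1) *i =
        la' k * (((-1) ^+ k * pade_const R k)%:C * (y *i) ^+ (2 * k).+1).
      rewrite imag_exprS [LHS]imagE
        [(_ * _ ^+ (2 * k).+1) *i]imagE [in RHS]mulrA [RHS]mulrCA; congr (_ * _).
      rewrite -!rmorphM; congr (_%:C); have kn0 := kN0 k.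
      transitivity (c * u`_k * w ^+ (2 * (n - k)) * y ^+ (2 * k).+1 *
                    ((-1) ^+ k * (-1) ^+ k)).
        by rewrite -exprMn mulrNN mulr1 expr1n mulr1.
      by rewrite /la; field.
    by rewrite /rho; ring.
  rewrite cmodN; apply: le_trans (ler_cmodD _ _) _; rewrite cmod_imag lerD //.
  apply: le_trans (ler_cmod_sum _ _ _) _; rewrite mulr_suml.
  apply: ler_sum => -[k kn] _ /=; rewrite cmodM cla.
  have -> : w * W = w ^+ (2 * (n - k)) * w ^+ (2 * k).+2.
    by rewrite -exprS -exprD; congr (_ ^+ _); move: kn; clear; lia.
  have -> : `|la k| * (2 * norm1 (q k)) * (w ^+ (2 * (n - k)) * w ^+ (2 * k).+2) =
    `|la k| * w ^+ (2 * (n - k)) * (2 * norm1 (q k) * w ^+ (2 * k).+2) by ring.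
  apply: ler_wpM2l; first by rewrite mulr_ge0 ?exprn_ge0 ?(ltW w0).
  apply: le_trans (cpade_rem k y1) _.
  rewrite ler_wpM2l ?mulr_ge0 ?norm1_ge0 //.
  by apply: lerXn2r; rewrite ?nnegrE ?(ltW w0).
have -> : P.[y *i] / Q - expi y = (P.[y *i] - expi y * Q) / Q.
  by rewrite mulrBl mulfK.
rewrite cmodM cmodV ler_pdivrMr; last by lra.
apply: le_trans hnum _; rewrite exprS -/W.
have E0 : 0 <= c * W + 2 * (K1 + c * K2) * (w * W).
  by do !(apply: addr_ge0 || apply: mulr_ge0) => //; exact: ltW.
(* The factor 2 in K pays for the division by 1 - K2 w, since w K2 <= 1/2. *)
apply: le_trans (ler_wpM2l E0 Q1).
have : w * W * (K1 + c * K2) * (w * K2) <= w * W * (K1 + c * K2) * (1 / 2).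
  apply: ler_wpM2l => //.
  by do !(apply: addr_ge0 || apply: mulr_ge0) => //; exact: ltW.
by lra.
Qed.
End UpperBound.

(** * Unitarity as a polynomial identity *)

Section Unitary.
Variable R : realType.
Local Open Scope complex_scope.
Local Notation ratfun := {fraction {poly R[i]}}.
Implicit Types (p q : {poly R[i]}) (w : R).

(* On the imaginary axis, [para p] takes the values conjugate to those of [p]. *)
Definition para p : {poly R[i]} := map_poly (@conjc R) p \Po - 'X.

Lemma paraM p q : para (p * q) = para p * para q.
Proof. by rewrite /para rmorphM /= comp_polyM. Qed.

Lemma horner_para p (x : R) : (para p).[x *i] = (p.[x *i])^*%C.
Proof.
rewrite /para horner_comp hornerN hornerX -horner_map; congr _.[_].
by apply/eqP; rewrite eq_complex /= oppr0 !eqxx.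
Qed.

Lemma cmod_conj (z : R[i]) : cmod z^*%C = cmod z.
Proof. by case: z => a b; rewrite /cmod /= sqrrN. Qed.

(** On the imaginary axis [para p * p] is |p|^2. *)
Lemma cmod_eq_para p q : para p * p = para q * q ->
  forall x : R, cmod p.[x *i] = cmod q.[x *i].
Proof.
move=> pq x; have := congr1 (fun f => cmod f.[x *i]) pq.
rewrite !hornerM !cmodM !horner_para !cmod_conj -!expr2.
by move/eqP; rewrite eqrXn2 ?cmod_ge0 // => /eqP.
Qed.

(** The identity passes to the reduced fraction by cancelling the nonzero [para p * p]. There it
    gives equal moduli on the axis, so a pole on the axis would be a common root of coprime
    polynomials. *)
Lemma unitary_frac n p q : (size p <= n.+1)%N -> (size q <= n.+1)%N ->
  p != 0 -> q != 0 -> para p * p = para q * q ->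
  unitary n (p%:F / q%:F : ratfun).
Proof.
move=> sp sq p0 q0 pq; split; first by exists p, q.
set r := _ / _; have d0 := rden_neq0 r.
have E : rnum r * q = p * rden r.
  apply/eqP; rewrite -tofrac_eq !tofracM eq_sym -eqr_div ?tofrac_eq0 //.
  by rewrite -rnum_rdenE.
have {}E : para (rnum r) * rnum r = para (rden r) * rden r.
  have qq0 : para p * p != 0.
    rewrite mulf_neq0 // /para comp_poly2_eq0 ?size_polyN ?size_polyX //.
    by rewrite map_poly_eq0.
  apply: (mulIf qq0); rewrite {1}pq mulrACA -paraM E.
  by rewrite paraM mulrACA mulrC.
have dx x : ~~ is_pole r (x *i).
  apply/negP => dz; have := coprimep_rnum_rden r.
  rewrite coprimep_sym => /coprimep_root/(_ dz)/negP; apply.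
  by rewrite -cmod_eq0 (cmod_eq_para E) (eqP dz) cmod0.
move=> x; split=> //; rewrite /reval cmodM cmodV (cmod_eq_para E) mulfV //.
by rewrite cmod_eq0; exact: dx.
Qed.

(** For real coefficients [para] is just the reflection s -> -s, hence it swaps P(s) and P(-s). *)
Lemma para_real (H : {poly R}) (P := map_poly (real_complex R) H) :
  para P = P \Po - 'X.
Proof.
rewrite /para -map_poly_comp; congr (_ \Po _); apply: eq_map_poly => x /=.
by apply/eqP; rewrite eq_complex /= oppr0 !eqxx.
Qed.

Lemma para_realN (H : {poly R}) (P := map_poly (real_complex R) H) :
  para (P \Po - 'X) = P.
Proof.
have XX : (- 'X) \Po (- 'X) = 'X :> {poly R[i]}.
  by rewrite raddfN /= comp_polyX opprK.
rewrite /para map_comp_poly rmorphN /= map_polyX -comp_polyA XX.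
rewrite comp_polyXr /P -map_poly_comp; apply: eq_map_poly => x /=.
by rewrite oppr0.
Qed.

End Unitary.

(** * Transfer to rational functions on i[-1, 1] *)

Section Errors.
Variable R : realType.
Local Open Scope complex_scope.
Local Notation ratfun := {fraction {poly R[i]}}.
Implicit Types (p q : {poly R[i]}) (w : R).

(** Since [fine] sends infinite values to 0, the two real bounds first serve to make the infimum
    finite. *)
Lemma best_error_bounds (S : set ratfun) (w L U : R) (r0 : ratfun) :
  S r0 -> (exp_dist w r0 <= U%:E)%E ->
  (forall r, S r -> (L%:E <= exp_dist w r)%E) ->
  L <= best_error S w <= U.
Proof.
move=> Sr0 r0U hL; rewrite /best_error; set I := ereal_inf _.
have LI : (L%:E <= I)%E by apply: le_ereal_inf_tmp => _ [r Sr <-]; apply: hL.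
have IU : (I <= U%:E)%E by apply: le_trans r0U; apply: ereal_inf_lbound; exists r0.
case: I LI IU => [v| |] //=; first by rewrite !lee_fin => -> ->.
Qed.

Lemma exp_dist_ge0 w (r : ratfun) : (0 <= exp_dist w r)%E.
Proof.
have x0 : (0 : R) \in `[-1, 1] by rewrite in_itv /= lerN10 ler01.
apply: (@le_trans _ _ (if is_pole r (0 *i) then +oo%E else
   (cmod (reval r (0 *i) - cexp (w%:C * (0 *i))))%:E)).
  by case: ifP => // _; rewrite lee_fin cmod_ge0.
by apply: ereal_sup_ubound; exists 0.
Qed.

Lemma ratset_error_ge n : exists2 K : R, 0 <= K & exists2 d : R, 0 < d <= 1 &
  forall w (r : ratfun), 0 < w < d -> ratset n r ->
  ((pade_const R n / 4 ^+ n * w ^+ (2 * n).+1 - K * w ^+ (2 * n).+2)%:E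
    <= exp_dist w r)%E.
Proof.
have [K K0 [d d01 hK]] := chebyshev_lower R n.
exists K => //; exists d => // w r wd [p [q [sp sq q0 rE]]].
have /andP[w0 _] := wd; have wN0 : w != 0 by rewrite gt_eqF.
(* Arguing by contradiction makes the distance finite and below c w^(2n+1), as [chebyshev_lower]
   requires. *)
set L := _ - _; rewrite leNgt; apply/negP => EL.
have LW : L <= pade_const R n / 4 ^+ n * w ^+ (2 * n).+1.
  by rewrite /L gerBl mulr_ge0 ?exprn_ge0 // ltW.
have E0 := exp_dist_ge0 w r.
have Ee : exp_dist w r = (fine (exp_dist w r))%:E.
  by rewrite fineK // ge0_fin_numE // (lt_le_trans EL) // leey.
set e := fine _ in Ee.
have e0 : 0 <= e by rewrite -lee_fin -Ee.
have eL : e < L by rewrite -lte_fin -Ee.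
(* The substitution z -> z/w carries the estimate from i[-1, 1] to i[-w, w] and keeps degrees. *)
pose sc p := p \Po ((w^-1)%:C *: 'X).
have scE p' y : (sc p').[y *i] = p'.[(y / w) *i].
  rewrite horner_comp hornerZ hornerX; congr _.[_].
  by apply/eqP; rewrite eq_complex /= !mul0r mulr0 subr0 addr0 mulrC !eqxx.
have sX : size ((w^-1)%:C *: 'X : {poly R[i]}) = 2.
  by rewrite size_scale ?size_polyX // fmorph_eq0 invr_eq0.
suff : L <= e by rewrite leNgt eL.
apply: (hK w e (sc p) (sc q)) => //.
- by rewrite e0 /= (le_trans (ltW eL)).
- by rewrite size_comp_poly2.
- by rewrite size_comp_poly2.
- by rewrite comp_poly2_eq0.
move=> y yw; rewrite !scE; set x := y / w.
have yE : y = w * x by rewrite mulrC divfK.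
have x1 : x \in `[-1, 1].
  by rewrite in_itv /= -ler_norml normrM normfV (gtr0_norm w0) ler_pdivrMr // mul1r.
have : ((if is_pole r (x *i) then +oo%E else
   (cmod (reval r (x *i) - cexp (w%:C * (x *i))))%:E) <= e%:E)%E.
  by rewrite -Ee; apply: ereal_sup_ubound; exists x.
case: ifPn => // dx; rewrite lee_fin cexp_imag -yE => hx.
have d0 : (rden r).[x *i] != 0 by [].
(* [q] may vanish on the segment when p/q is not reduced, so the comparison goes through the reduced
   denominator. *)
have pq : p * rden r = rnum r * q.
  apply/eqP; rewrite -tofrac_eq !tofracM -eqr_div ?tofrac_eq0 ?rden_neq0 //.
  by rewrite -rnum_rdenE rE.
have -> : p.[x *i] - expi y * q.[x *i] = (reval r (x *i) - expi y) * q.[x *i].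
  apply: (mulIf d0); rewrite mulrBl -hornerM pq hornerM /reval.
  by rewrite [in RHS]mulrAC mulrBl divfK //; ring.
by rewrite cmodM ler_wpM2r ?cmod_ge0.
Qed.

Lemma unitary_error_le n : exists2 K : R, 0 <= K & exists2 d : R, 0 < d <= 1 &
  forall w, 0 < w < d -> exists2 r : ratfun, unitary n r &
  (exp_dist w r <= (pade_const R n / 4 ^+ n * w ^+ (2 * n).+1 +
                    K * w ^+ (2 * n).+2)%:E)%E.
Proof.
have [K K0 [d d01 hK]] := chebyshev_upper R n.
exists K => //; exists d => // w wd.
have /andP[w0 _] := wd; have wN0 : w != 0 by rewrite gt_eqF.
have [H [sH hH]] := hK w wd; set U := (_ + _ : R) in hH *.
(* The substitution z -> w z brings the pair back to i[-1, 1]. *)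
pose G := H \Po (w *: 'X); pose P := map_poly (real_complex R) G.
have sX : size (w *: 'X : {poly R}) = 2 by rewrite size_scale ?size_polyX.
have PE x : P.[x *i] = (map_poly (real_complex R) H).[(w * x) *i].
  rewrite /P map_comp_poly horner_comp map_polyZ map_polyX hornerZ hornerX.
  by congr _.[_]; apply/eqP; rewrite eq_complex /= !mul0r mulr0 subr0 addr0 !eqxx.
have NX : size (- 'X : {poly R[i]}) = 2 by rewrite size_polyN size_polyX.
have QE x : (P \Po - 'X).[x *i] = (map_poly (real_complex R) H \Po - 'X).[(w * x) *i].
  have Ni (t : R) : - (t *i) = (- t) *i by apply/eqP; rewrite eq_complex /= oppr0 !eqxx.
  by rewrite !horner_comp !hornerN !hornerX !Ni PE mulrN.
have yw x : x \in `[-1, 1] -> `|w * x| <= w.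
  rewrite in_itv /= -ler_norml => x1.
  by rewrite normrM (gtr0_norm w0) ler_piMr // ltW.
have P0 : P != 0.
  have := hH 0; rewrite normr0 (ltW w0) => /(_ isT)[+ _]; apply: contraNneq => P0.
  by have := QE 0; rewrite mulr0 => <-; rewrite P0 comp_poly0 horner0.
exists (P%:F / (P \Po - 'X)%:F).
  apply: unitary_frac; rewrite ?size_comp_poly2 ?comp_poly2_eq0 //.
  - by rewrite (leq_trans (size_poly _ _)) // size_comp_poly2.
  - by rewrite (leq_trans (size_poly _ _)) // size_comp_poly2.
  - by rewrite para_real para_realN mulrC.
apply: ge_ereal_sup => _ [x x1 <-].
have [D0 hx] := hH (w * x) (yw x x1).
have [np ->] := @reval_frac R P (P \Po - 'X) (x *i) (eq_ind_r (fun z => z != 0) D0 (QE x)).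
by rewrite (negPf np) lee_fin PE QE cexp_imag.
Qed.

End Errors.

(** * Asymptotics as w tends to 0 from the right *)

Lemma eqaddO_at_right0 (R : realType) (f g h : R -> R) (K d : R) : 0 <= K ->
  0 < d -> (forall w, 0 < w < d -> `|f w - g w| <= K * `|h w|) ->
  f = g +O_ (0^'+) h.
Proof.
(* K + 1 because the constant must be positive, while K may be 0. *)
move=> K0 d0 fgh; apply/eqaddOP; apply/bigO_exP; exists (K + 1).
  by rewrite ltr_pwDr.
near=> w.
have w0 : 0 < w by near: w; exact: nbhs_right_gt.
have wd : w < d by near: w; exact: nbhs_right_lt.
apply: le_trans (fgh w _) _; first by rewrite w0.
by rewrite ler_wpM2r // lerDl.
Unshelve. all: by end_near. Qed.

Theorem proposition2 (R : realType) (n : nat) :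
  let c : R := 2 ^- (2 * n) * n`!%:R ^+ 2 / ((2 * n)`!%:R * (2 * n + 1)`!%:R) in
  unitary_error n =
    (fun w => c * w ^+ (2 * n + 1)) +O_ (0^'+) (fun w => w ^+ (2 * n + 2))
  /\
  chebyshev_error n =
    (fun w => c * w ^+ (2 * n + 1)) +O_ (0^'+) (fun w => w ^+ (2 * n + 2)).
Proof.
have [K1 K10 [d1 /andP[d10 _] h1]] := ratset_error_ge R n.
have [K2 K20 [d2 /andP[d20 _] h2]] := unitary_error_le R n.
have -> : 2 ^- (2 * n) * n`!%:R ^+ 2 / ((2 * n)`!%:R * (2 * n + 1)`!%:R) =
    pade_const R n / 4 ^+ n.
  have -> : 2 ^+ (2 * n) = 4 ^+ n :> R.
    by rewrite exprM; congr (_ ^+ _); rewrite expr2; ring.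
  by rewrite /pade_const; ring.
move=> c; rewrite addn1 addn2.
(* Both errors are instances of one squeeze: a unitary competitor bounds from above, the lower bound
   for all of R_n from below. *)
suff bound S : unitary n `<=` S -> S `<=` ratset n ->
    best_error S = (fun w => c * w ^+ (2 * n).+1) +O_ (0^'+)
                   (fun w : R => w ^+ (2 * n).+2).
  by split; apply: bound => // r [].
move=> uS Sr; apply: (@eqaddO_at_right0 _ _ _ _ (K1 + K2) (Num.min d1 d2)).
- by rewrite addr_ge0.
- by rewrite lt_min d10.
move=> w; rewrite lt_min => /and3P[w0 wd1 wd2].
have [|r /uS Sr' hr] := h2 w; first by rewrite w0.
have /andP[lo up] := best_error_bounds Sr' hr (fun r' Sr'' =>
  h1 w r' (introT andP (conj w0 wd1)) (Sr r' Sr'')).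
have W0 : 0 <= w ^+ (2 * n).+2 by rewrite exprn_ge0 // ltW.
rewrite [`|w ^+ _|]ger0_norm // ler_norml.
have := mulr_ge0 K10 W0; have := mulr_ge0 K20 W0; move: lo up.
rewrite -/c => lo up k1 k2; rewrite mulrDl; apply/andP; split; lra.
Qed.
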